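(* Let $M$ be rich, let $f,g:M\to\mathcal P(V)$ with $f(m)\le g(m)$ for all $m\in M$, let $L=J\cup J'\cup J''$ be a disjoint union, let $f$ be insensitive to $J$ and $g$ insensitive to $J''$. Then $f^+(m_{J'})$, i.e. the function $h:M\to\mathcal P(V)$ defined by $$h(m)=\bigcup\{f(m'): m'\in M,\ m\restriction J'=m'\restriction J'\},$$ is an interpolant for $f$ and $g$: $f(m)\le h(m)\le g(m)$ for all $m\in M$, and $h$ is insensitive to $J\cup J''$.
   Context: $V$ is a set (of arguments) with a partial order $\preceq$. For $A,B\subseteq V$: $A\le B$ iff for all $a\in A$ there is $b\in B$ with $a\preceq b$. The supremum of a family of argument sets is their union. $L$ is the set of propositional variables and $M$ is a set of models, i.e. of functions $m$ with domain $L$ (into a fixed set); $m\restriction J$ is the restriction of $m$ to $J\subseteq L$. $M$ is rich if for all $m,m'\in M$ and $J\subseteq L$, $(m\restriction J)\cup(m'\restriction(L\setminus J))\in M$. A function $f$ on $M$ is insensitive to $J\subseteq L$ if $m\restriction(L\setminus J)=n\restriction(L\setminus J)$ implies $f(m)=f(n)$ for all $m,n\in M$. *)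

(* Defs.v *)
From mathcomp Require Export all_boot all_order.
From mathcomp Require Export boolp classical_sets functions.

Set Implicit Arguments.
Unset Strict Implicit.
Unset Printing Implicit Defensive.

#[global] Open Scope classical_set_scope.

(* The propositional variables are the elements of a type [L], truth values
   those of a type [X]; a model is a function [L -> X].  A function on a set [M]
   of models has as domain the subtype coerced from [M].  The restriction of
   [m] to [J] is [sigL J m : J -> X]. *)

Definition le_set {d : Order.disp_t} {V : porderType d} (A B : set V) : Prop :=
  forall a, A a -> exists2 b, B b & (a <= b)%O.

(* [patch m' J m] is [m] on [J] and [m'] on the complement of [J]. *)
Definition rich {L X : Type} (M : set (L -> X)) : Prop :=
  forall (m m' : L -> X) (J : set L), M m -> M m' -> M (patch m' J m).

Definition insensitive {L X Y : Type} {M : set (L -> X)} (f : M -> Y)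
    (J : set L) : Prop :=
  forall m n : M, sigL (~` J) (val m) = sigL (~` J) (val n) -> f m = f n.

Definition fplus {L X V : Type} {M : set (L -> X)} (f : M -> set V)
    (J' : set L) (m : M) : set V :=
  \bigcup_(m' in [set m' : M | sigL J' (val m) = sigL J' (val m')]) f m'.

(* Main.v *)
Require Import Defs.

(** The lower bound holds because [m] is itself one of the models over which
    the union defining the interpolant ranges.  For the upper bound, let [m']
    agree with [m] on [J'].  Richness supplies the model [n] that is [m] on [J]
    and [m'] elsewhere.  It differs from [m'] only on [J], so [f n = f m']; on
    [J'] it equals [m'], hence [m], so it differs from [m] only on [J''] and
    [g n = g m].  The hypothesis at [n] then reads [f m' <= g m]; this is
    [le_set_glue].  Finally the interpolant looks at [m] only through its
    restriction to [J'], which is disjoint from [J] and [J'']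
    ([insensitive_fplus]). *)

Lemma insensitiveP {L X Y : Type} {M : set (L -> X)} {f : M -> Y} {J : set L}
    {m n : M} :
  insensitive f J -> (forall x, ~ J x -> val m x = val n x) -> f m = f n.
Proof. by move=> fJ mn; apply: fJ; apply/eq_sigLP => x /set_mem; exact: mn. Qed.

(** The pointwise form of the upper bound: [f m'] and [g m] are the values of
    [f] and [g] at one common model, glued from [m] on [J] and [m'] off [J]. *)
Lemma le_set_glue {d : Order.disp_t} {V : porderType d} {L X : Type}
    {M : set (L -> X)} {f g : M -> set V} {J J' J'' : set L} {m m' : M} :
  rich M ->
  (forall n : M, le_set (f n) (g n)) ->
  J `|` J' `|` J'' = setT ->
  insensitive f J -> insensitive g J'' ->
  sigL J' (val m) = sigL J' (val m') ->
  le_set (f m') (g m).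
Proof.
move=> richM fg cover fJ gJ'' /eq_sigLP mm'.
have Mn : M (patch (val m') J (val m)).
  by apply: richM; apply: set_mem; exact: valP.
pose n : M := SigSub (mem_set Mn).
have fn : f n = f m'.
  by apply: (insensitiveP fJ) => x Jx; rewrite /= patchC ?mem_set.
have gn : g n = g m.
  apply: (insensitiveP gJ'') => x J''x /=.
  have [Jx|Jx] := pselect (J x); first by rewrite patchT ?mem_set.
  have J'x : J' x by have : [set: L] x by []; rewrite -cover => -[[|]|].
  by rewrite patchC ?mem_set// mm' ?mem_set.
by rewrite -fn -gn; exact: fg.
Qed.

Lemma insensitive_fplus (L X V : Type) (M : set (L -> X)) (f : M -> set V)
    (J' K : set L) :
  J' `&` K = set0 -> insensitive (fplus f J') K.
Proof.
move=> J'K m n /eq_sigLP mn; rewrite /fplus.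
suff -> : sigL J' (val m) = sigL J' (val n) by [].
apply/eq_sigLP => x /set_mem J'x; apply: mn; apply: mem_set => Kx.
by have : (J' `&` K) x by []; rewrite J'K.
Qed.

Theorem fact5p5p3 (d : Order.disp_t) (V : porderType d) (L X : Type)
  (M : set (L -> X)) (f g : M -> set V) (J J' J'' : set L) :
  rich M ->
  (forall m : M, le_set (f m) (g m)) ->
  J `|` J' `|` J'' = setT ->
  J `&` J' = set0 -> J `&` J'' = set0 -> J' `&` J'' = set0 ->
  insensitive f J ->
  insensitive g J'' ->
  (forall m : M, le_set (f m) (fplus f J' m) /\ le_set (fplus f J' m) (g m)) /\
  insensitive (fplus f J') (J `|` J'').
Proof.
move=> richM fg cover JJ' _ J'J'' fJ gJ''; split.
  move=> m; split; first by move=> a fma; exists a => //; exists m.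
  by move=> a [m' /= mm' fa]; exact: (le_set_glue richM fg cover fJ gJ'' mm').
by apply: insensitive_fplus; rewrite setIUr setIC JJ' J'J'' setU0.
Qed.
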